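(* Let $\varphi$, $\bar x$, $(\bar v,\bar u)=(0,0)$ and $\bar y\in Y(\bar x,\bar u,\bar v)$ be as in the setting described in the context. Then the primal-dual pair $(\bar x,\bar y)$ is fully stable in $\bar{\mathcal P}$ if and only if there exist neighborhoods $\mathcal X\times\mathcal Y$ of $(\bar x,\bar y)$ and $\mathcal V\times\mathcal U$ of $(\bar v,\bar u)=(0,0)$ such that the mapping $$(v,u)\in\mathcal V\times\mathcal U\ \mapsto\ (x,y)\in\bar M(v,u)\cap[\mathcal X\times\mathcal Y]$$ is single-valued and Lipschitz continuous, with $x$ always a local minimizer in $\mathcal P(v,u)$ relative to $\mathcal X$ (i.e., $x$ minimizes $\varphi(\cdot,u)-v\cdot(\cdot)$ over $\mathcal X$).
   Context: **Subgradients.** For a lower semicontinuous $f:\mathbb R^N\to(-\infty,\infty]$ and $z$ with $f(z)$ finite: $w$ is a regular subgradient at $z$ if $f(z')\ge f(z)+w\cdot(z'-z)+o(|z'-z|)$; $\partial f(z)$ is the set of (general, limiting) subgradients, i.e. limits of regular subgradients $w_k$ at points $z_k\to z$ with $f(z_k)\to f(z)$; $\partial^\infty f(z)$ (horizon subgradients) is the set of limits of $\lambda_kw_k$ with $\lambda_k\searrow0$ and $w_k$ regular subgradients at $z_k\to z$, $f(z_k)\to f(z)$. **Setting.** $\varphi:\mathbb R^n\times\mathbb R^m\to(-\infty,\infty]$ is a closed (lower semicontinuous) proper function. $\mathcal P(v,u)$ is the problem: minimize $\varphi(x,u)-v\cdot x$ with respect to $x$. $(\bar v,\bar u)=(0,0)$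 and $\bar{\mathcal P}=\mathcal P(\bar v,\bar u)$. $\bar x$ is a locally optimal solution to $\bar{\mathcal P}$. $\partial_x\varphi(x,u)$ is the set of subgradients of $\varphi(\cdot,u)$ at $x$. For $(x,u,v)$ with $v\in\partial_x\varphi(x,u)$ put $Y(x,u,v)=\{y: (v,y)\in\partial\varphi(x,u)\}$ (and $Y(x,u,v)=\emptyset$ otherwise). Standing assumptions: (i) basic constraint qualification: $(0,y)\in\partial^\infty\varphi(\bar x,\bar u)\Rightarrow y=0$; (ii) for every $\hat y\in Y(\bar x,\bar u,\bar v)$, $\varphi$ is continuously prox-regular at $(\bar x,\bar u)$ for $(\bar v,\hat y)$, meaning there are neighborhoods $\mathcal X\times\mathcal U$ of $(\bar x,\bar u)$ and $\mathcal V\times\mathcal Y$ of $(\bar v,\hat y)$ and $r>0$ such that $\varphi(x',u')\ge\varphi(x,u)+(v,y)\cdot(x'-x,u'-u)-\frac r2|(x'-x,u'-u)|^2$ for all $(x,u),(x',u')\in\mathcal X\times\mathcal U$ and $(v,y)\in\partial\varphi(x,u)\cap[\mathcal V\times\mathcal Y]$, and moreover the function $(x,u,v,y)\in\operatorname{gph}\partial\varphi\mapsto\varphi(x,u)$ is continuous in $\mathcal X\times\mathcal U\times\mathcal V\times\mathcal Y$. A multiplier vector $\bar y\in Y(\bar x,\bar u,\bar v)$ is fixed. **Solution mappings.** $\bar M(v,u)=\{(x,y):(v,y)\in\partial\varphi(x,u)\}$; $M_\delta(v,u)=\operatorname{argmin}_{|x-\bar x|\le\delta}\{\varphi(x,u)-v\cdot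 x\}$; $m_\delta(v,u)=\min_{|x-\bar x|\le\delta}\{\varphi(x,u)-v\cdot x\}$; $\bar M_\delta(v,u)=\{(x,y): x\in M_\delta(v,u),\ y\in Y(x,u,v),\ |y-\bar y|\le\delta\}$. **Primal-dual full stability.** $(\bar x,\bar y)$ is fully stable in $\bar{\mathcal P}$ if for every sufficiently small $\delta>0$ there is a neighborhood $\mathcal V\times\mathcal U$ of $(\bar v,\bar u)=(0,0)$ on which $\bar M_\delta$ is single-valued (exactly one element) and Lipschitz continuous and $m_\delta$ is Lipschitz continuous. *)

(* Defs.v *)
From HB Require Import structures.
From mathcomp Require Import all_boot all_order all_algebra.
From mathcomp Require Import all_classical all_reals all_analysis.
Set Implicit Arguments.
Unset Strict Implicit.
Unset Printing Implicit Defensive.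
Import Order.TTheory GRing.Theory Num.Theory numFieldNormedType.Exports.
Local Open Scope classical_set_scope.
Local Open Scope ring_scope.

(* R^N is 'rV[R]_N; its library norm is the sup norm.  The Euclidean norm is
   used wherever an actual norm value matters; the topology is the same. *)
Definition dot (R : realType) (N : nat) (a b : 'rV[R]_N) : R :=
  \sum_(i < N) a ord0 i * b ord0 i.

Definition enorm (R : realType) (N : nat) (a : 'rV[R]_N) : R :=
  Num.sqrt (dot a a).

Definition proper_fun (R : realType) (N : nat) (f : 'rV[R]_N -> \bar R) : Prop :=
  (forall z, f z != -oo%E) /\ (exists z, f z \is a fin_num).

(* Second component: f z' >= f z + w.(z' - z) + o(|z' - z|). *)
Definition regular_subgradient (R : realType) (N : nat)
    (f : 'rV[R]_N -> \bar R) (z w : 'rV[R]_N) : Prop :=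
  f z \is a fin_num /\
  forall eps : R, 0 < eps -> \forall z' \near z,
    (f z + (dot w (z' - z) - eps * enorm (z' - z))%:E <= f z')%E.

Definition subdiff (R : realType) (N : nat)
    (f : 'rV[R]_N -> \bar R) (z : 'rV[R]_N) : set 'rV[R]_N :=
  [set w | f z \is a fin_num /\
    exists (z_ w_ : nat -> 'rV[R]_N),
      [/\ z_ @ \oo --> z,
          (fun k => f (z_ k)) @ \oo --> f z,
          forall k, regular_subgradient f (z_ k) (w_ k)
        & w_ @ \oo --> w]].

Definition horizon_subdiff (R : realType) (N : nat)
    (f : 'rV[R]_N -> \bar R) (z : 'rV[R]_N) : set 'rV[R]_N :=
  [set w | f z \is a fin_num /\
    exists (z_ w_ : nat -> 'rV[R]_N) (lambda_ : nat -> R),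
      [/\ z_ @ \oo --> z,
          (fun k => f (z_ k)) @ \oo --> f z,
          forall k, regular_subgradient f (z_ k) (w_ k),
          (forall k, 0 < lambda_ k) /\ lambda_ @ \oo --> 0
        & (fun k => lambda_ k *: w_ k) @ \oo --> w]].

(* The minimum value is required to be finite, so that a function identically
   +oo on A has no minimizer there. *)
Definition argmin (R : realType) (T : Type) (f : T -> \bar R) (A : set T) :
    set T :=
  [set x | [/\ A x, f x \is a fin_num & forall x', A x' -> (f x <= f x')%E]].

(* The set-valued mapping F has exactly one value at each point of D, and that
   value depends Lipschitz continuously on the point.  Lipschitz continuity is
   with respect to the library norms, equivalent to the Euclidean ones. *)
Definition single_valued_lipschitz (R : realType) (V W : normedModType R)
    (F : V -> set W) (D : set V) : Prop :=
  exists g : V -> W,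
    (forall p, D p -> F p = [set g p]) /\ [lipschitz g p | p in D].

Definition finite_lipschitz (R : realType) (V : normedModType R)
    (f : V -> \bar R) (D : set V) : Prop :=
  (forall p, D p -> f p \is a fin_num) /\
  [lipschitz (fine (f p) : R^o) | p in D].

(* A point (x, u) of R^n x R^m is row_mx x u in R^(n + m); likewise for the
   subgradients (v, y). *)

Definition objective (R : realType) (n m : nat)
    (phi : 'rV[R]_(n + m) -> \bar R) (v : 'rV[R]_n) (u : 'rV[R]_m)
    (x : 'rV[R]_n) : \bar R :=
  (phi (row_mx x u) - (dot v x)%:E)%E.

Definition locally_optimal (R : realType) (n m : nat)
    (phi : 'rV[R]_(n + m) -> \bar R) (v : 'rV[R]_n) (u : 'rV[R]_m)
    (x : 'rV[R]_n) : Prop :=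
  exists2 X : set 'rV[R]_n, nbhs x X & argmin (objective phi v u) X x.

Definition subdiff_x (R : realType) (n m : nat)
    (phi : 'rV[R]_(n + m) -> \bar R) (x : 'rV[R]_n) (u : 'rV[R]_m) :
    set 'rV[R]_n :=
  subdiff (fun x' => phi (row_mx x' u)) x.

Definition multipliers (R : realType) (n m : nat)
    (phi : 'rV[R]_(n + m) -> \bar R) (x : 'rV[R]_n) (u : 'rV[R]_m)
    (v : 'rV[R]_n) : set 'rV[R]_m :=
  [set y | subdiff_x phi x u v /\ subdiff phi (row_mx x u) (row_mx v y)].

Definition basic_CQ (R : realType) (n m : nat)
    (phi : 'rV[R]_(n + m) -> \bar R) (x : 'rV[R]_n) (u : 'rV[R]_m) : Prop :=
  forall y : 'rV[R]_m,
    horizon_subdiff phi (row_mx x u) (row_mx 0 y) -> y = 0.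

Definition continuously_prox_regular (R : realType) (n m : nat)
    (phi : 'rV[R]_(n + m) -> \bar R) (xbar : 'rV[R]_n) (ubar : 'rV[R]_m)
    (vbar : 'rV[R]_n) (yhat : 'rV[R]_m) : Prop :=
  exists (X : set 'rV[R]_n) (U : set 'rV[R]_m)
         (V : set 'rV[R]_n) (Y : set 'rV[R]_m) (r : R),
    [/\ [/\ nbhs xbar X, nbhs ubar U, nbhs vbar V & nbhs yhat Y],
        0 < r,
        forall x u x' u' v y, X x -> U u -> X x' -> U u' -> V v -> Y y ->
          subdiff phi (row_mx x u) (row_mx v y) ->
          (phi (row_mx x u)
             + (dot (row_mx v y) (row_mx (x' - x) (u' - u))
                - r / 2 * enorm (row_mx (x' - x) (u' - u)) ^+ 2)%:E
           <= phi (row_mx x' u'))%E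
      & {within [set q : 'rV[R]_(n + m) * 'rV[R]_(n + m) |
            [/\ subdiff phi q.1 q.2,
                X (lsubmx q.1), U (rsubmx q.1),
                V (lsubmx q.2) & Y (rsubmx q.2)]],
          continuous (fun q => phi q.1)}].

Definition Mbar (R : realType) (n m : nat)
    (phi : 'rV[R]_(n + m) -> \bar R) (p : 'rV[R]_n * 'rV[R]_m) :
    set ('rV[R]_n * 'rV[R]_m) :=
  [set q | subdiff phi (row_mx q.1 p.2) (row_mx p.1 q.2)].

Definition Mdelta (R : realType) (n m : nat)
    (phi : 'rV[R]_(n + m) -> \bar R) (xbar : 'rV[R]_n) (delta : R)
    (p : 'rV[R]_n * 'rV[R]_m) : set 'rV[R]_n :=
  argmin (objective phi p.1 p.2) [set x | enorm (x - xbar) <= delta].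

Definition mdelta (R : realType) (n m : nat)
    (phi : 'rV[R]_(n + m) -> \bar R) (xbar : 'rV[R]_n) (delta : R)
    (p : 'rV[R]_n * 'rV[R]_m) : \bar R :=
  ereal_inf (objective phi p.1 p.2 @` [set x | enorm (x - xbar) <= delta]).

Definition Mbardelta (R : realType) (n m : nat)
    (phi : 'rV[R]_(n + m) -> \bar R) (xbar : 'rV[R]_n) (ybar : 'rV[R]_m)
    (delta : R) (p : 'rV[R]_n * 'rV[R]_m) : set ('rV[R]_n * 'rV[R]_m) :=
  [set q | [/\ Mdelta phi xbar delta p q.1,
               multipliers phi q.1 p.2 p.1 q.2
             & enorm (q.2 - ybar) <= delta]].

(* Primal-dual full stability, for the reference parameters (0, 0). *)
Definition fully_stable (R : realType) (n m : nat)
    (phi : 'rV[R]_(n + m) -> \bar R) (xbar : 'rV[R]_n) (ybar : 'rV[R]_m) :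
    Prop :=
  exists2 delta0 : R, 0 < delta0 &
    forall delta : R, 0 < delta -> delta < delta0 ->
      exists (V : set 'rV[R]_n) (U : set 'rV[R]_m),
        [/\ nbhs (0 : 'rV[R]_n) V, nbhs (0 : 'rV[R]_m) U,
            single_valued_lipschitz (Mbardelta phi xbar ybar delta) (V `*` U)
          & finite_lipschitz (mdelta phi xbar delta) (V `*` U)].

(* Main.v *)
Require Import Defs.
From HB Require Import structures.
From mathcomp Require Import all_boot all_order all_algebra.
From mathcomp Require Import all_classical all_reals all_analysis.
From mathcomp Require Import ring lra.
Set Implicit Arguments.
Unset Strict Implicit.
Unset Printing Implicit Defensive.
Import Order.TTheory GRing.Theory Num.Theory numFieldNormedType.Exports.
Local Open Scope classical_set_scope.
Local Open Scope ring_scope.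

(* For fixed u, the function v |-> - m_delta(v, u) is convex and the Lipschitz
   solution x(v, u) is a subgradient selection of it.  Given (v, y) in the
   subdifferential of phi at (x, u) near the reference point, a Moreau-type
   regularization of that convex function has a minimizer w with
   v + r x = w + r x(w, u); comparing the minimality of x(w, u) with the
   prox-regularity inequality at (x, u) forces w = v and x(v, u) = x, so that
   nearby elements of Mbar come from minimizers.  Conversely a localization of
   Mbar by minimizers is Mbar_delta for small delta, since a minimizer in x
   makes v a regular subgradient, and m_delta is Lipschitz by the
   prox-regularity inequality applied in both directions between two
   solutions. *)

(** * Dot product, and comparison of the Euclidean norm with the sup norm *)

Lemma dotC (R : realType) (N : nat) (a b : 'rV[R]_N) : dot a b = dot b a.
Proof. by apply: eq_bigr => i _; rewrite mulrC. Qed.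

Lemma dotDl (R : realType) (N : nat) (a b c : 'rV[R]_N) :
  dot (a + b) c = dot a c + dot b c.
Proof. by rewrite /dot -big_split; apply: eq_bigr => i _; rewrite mxE mulrDl. Qed.

Lemma dotZl (R : realType) (N : nat) (k : R) (a b : 'rV[R]_N) :
  dot (k *: a) b = k * dot a b.
Proof. by rewrite /dot mulr_sumr; apply: eq_bigr => i _; rewrite mxE mulrA. Qed.

Lemma dotNl (R : realType) (N : nat) (a b : 'rV[R]_N) : dot (- a) b = - dot a b.
Proof. by rewrite -scaleN1r dotZl mulN1r. Qed.

Lemma dotDr (R : realType) (N : nat) (a b c : 'rV[R]_N) :
  dot c (a + b) = dot c a + dot c b.
Proof. by rewrite dotC dotDl !(dotC c). Qed.

Lemma dotZr (R : realType) (N : nat) (k : R) (a b : 'rV[R]_N) :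
  dot b (k *: a) = k * dot b a.
Proof. by rewrite dotC dotZl dotC. Qed.

Lemma dotNr (R : realType) (N : nat) (a b : 'rV[R]_N) : dot b (- a) = - dot b a.
Proof. by rewrite dotC dotNl dotC. Qed.

Lemma dot0l (R : realType) (N : nat) (a : 'rV[R]_N) : dot 0 a = 0.
Proof. by rewrite -(scale0r 0) dotZl mul0r. Qed.

Definition dotE := (dotDl, dotDr, dotNl, dotNr, dotZl, dotZr).

Lemma dot_ge0 (R : realType) (N : nat) (a : 'rV[R]_N) : 0 <= dot a a.
Proof. by apply: sumr_ge0 => i _; rewrite -expr2 sqr_ge0. Qed.

Lemma enorm_sqr (R : realType) (N : nat) (a : 'rV[R]_N) : enorm a ^+ 2 = dot a a.
Proof. by rewrite sqr_sqrtr// dot_ge0. Qed.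

Lemma enorm_ge0 (R : realType) (N : nat) (a : 'rV[R]_N) : 0 <= enorm a.
Proof. exact: sqrtr_ge0. Qed.

Lemma coord_le_norm (R : realType) (N : nat) (a : 'rV[R]_N) (i : 'I_N) :
  `|a ord0 i| <= `|a|.
Proof.
rewrite [leRHS]/Num.norm /= mx_normrE.
by apply: (le_bigmax _ (fun ij : 'I_1 * 'I_N => `|a ij.1 ij.2|) (ord0, i)).
Qed.

Lemma sqr_norm_le_dot (R : realType) (N : nat) (a : 'rV[R]_N) :
  `|a| ^+ 2 <= dot a a.
Proof.
have [-> |a0] := eqVneq `|a| 0; first by rewrite expr0n dot_ge0.
rewrite [`|a|]/Num.norm /= in a0 *.
have [[i j] ->] := mx_norm_neq0 a0.
rewrite /= [i]ord1 real_normK ?num_real// /dot (bigD1 j)//= -expr2 lerDl.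
by apply: sumr_ge0 => k _; rewrite -expr2 sqr_ge0.
Qed.

Lemma dot_eq0 (R : realType) (N : nat) (a : 'rV[R]_N) : dot a a <= 0 -> a = 0.
Proof.
move=> a0; apply/eqP; rewrite -normr_eq0 -sqrf_eq0 eq_le sqr_ge0 andbT.
exact: le_trans (sqr_norm_le_dot a) a0.
Qed.

Lemma normr_dot_le (R : realType) (N : nat) (a b : 'rV[R]_N) :
  `|dot a b| <= N%:R * `|a| * `|b|.
Proof.
apply: le_trans (ler_norm_sum _ _ _) _.
apply: (@le_trans _ _ (\sum_(i < N) `|a| * `|b|)); last first.
  by rewrite sumr_const card_ord -mulrA mulr_natl.
by apply: ler_sum => i _; rewrite normrM ler_pM// coord_le_norm.
Qed.

Lemma norm_le_enorm (R : realType) (N : nat) (a : 'rV[R]_N) : `|a| <= enorm a.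
Proof.
by rewrite -(ler_pXn2r (ltn0Sn 1)) ?nnegrE ?enorm_ge0// enorm_sqr sqr_norm_le_dot.
Qed.

(** The factor [N.+1] is crude, but it stays positive for [N = 0], so radii can be divided by it. *)
Lemma enorm_le_norm (R : realType) (N : nat) (a : 'rV[R]_N) :
  enorm a <= N.+1%:R * `|a|.
Proof.
rewrite -(ler_pXn2r (ltn0Sn 1)) ?nnegrE ?enorm_ge0 ?mulr_ge0//.
rewrite enorm_sqr (le_trans (ler_norm _)) // (le_trans (normr_dot_le _ _))//.
rewrite exprMn -mulrA -expr2 ler_wpM2r ?sqr_ge0// -natrX ler_nat.
by rewrite (leq_trans (leqnSn _))// leq_pmulr.
Qed.

Lemma dot_row_mx (R : realType) (n m : nat) (a c : 'rV[R]_n) (b d : 'rV[R]_m) :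
  dot (row_mx a b) (row_mx c d) = dot a c + dot b d.
Proof.
rewrite /dot big_split_ord /=; congr (_ + _); apply: eq_bigr => i _.
  by rewrite !row_mxEl.
by rewrite !row_mxEr.
Qed.

(** * Neighborhoods and Lipschitz maps through explicit radii and constants *)

Lemma nbhs_norm_le (R : realType) (V : normedModType R) (x : V) (A : set V) :
  nbhs x A <-> exists2 e : R, 0 < e & forall y, `|y - x| <= e -> A y.
Proof.
split=> [/nbhs_normP [e /= e0 eA]|[e e0 eA]].
  exists (e / 2); first by rewrite divr_gt0.
  move=> y yx; apply: eA => /=; rewrite distrC (le_lt_trans yx)//.
  by rewrite gtr_pMr// invf_lt1// ltr1n.
by apply/nbhs_normP; exists e => // y /= yx; apply: eA; rewrite distrC ltW.
Qed.

Lemma nbhs_enorm_le (R : realType) (N : nat) (x : 'rV[R]_N) (d : R) :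
  0 < d -> nbhs x [set z | enorm (z - x) <= d].
Proof.
move=> d0; apply/nbhs_norm_le; exists (d / N.+1%:R); first by rewrite divr_gt0.
move=> z zx /=; rewrite (le_trans (enorm_le_norm _))// mulrC.
by rewrite -ler_pdivlMr.
Qed.

(** The library quantifies over all constants near infinity; a single positive one is extracted, by
    which radii can be divided. *)
Lemma lipschitzP (R : realType) (V W : normedModType R) (f : V -> W) (A : set V) :
  [lipschitz f x | x in A] <->
  exists2 k : R, 0 < k &
    forall x y, A x -> A y -> `|f x - f y| <= k * `|x - y|.
Proof.
split=> [[M [_ fM]]|[k k0 fk]].
  exists (`|M| + 1) => [|x y Ax Ay]; first by rewrite ltr_wpDl.
  apply: (fM (`|M| + 1) _ (x, y)) => //=.
  by rewrite (le_lt_trans (ler_norm M))// ltrDl.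
exists k; split=> [|M kM [x y] [/= Ax Ay]]; first exact: num_real.
by rewrite (le_trans (fk _ _ Ax Ay))// ler_wpM2r// ltW.
Qed.

Lemma lipschitz_within_continuous (R : realType) (V W : normedModType R)
    (f : V -> W) (A : set V) :
  [lipschitz f x | x in A] -> {within A, continuous f}.
Proof.
move=> /lipschitzP[k k0 fk]; apply/subspace_continuousP => x Ax.
apply/cvgrPdist_le => e e0; rewrite near_withinE.
apply/nbhs_norm_le; exists (e / k) => [|y yx Ay]; first by rewrite divr_gt0.
by rewrite (le_trans (fk _ _ Ax Ay))// distrC mulrC -ler_pdivlMr.
Qed.

(** * Regularized minimization over the tilt vector *)

Lemma dot_sqrB (R : realType) (N : nat) (a b c : 'rV[R]_N) :
  dot (a - c) (a - c) - dot (b - c) (b - c) = dot (a - b) (a + b - 2 *: c).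
Proof. by rewrite !dotE (dotC c a) (dotC c b) (dotC b a); ring. Qed.

(** Expanding [|b - a|^2 >= 0] gives [|b|^2 >= 2 a.b - |a|^2], and the hypothesis bounds the right
    side below by [|a|^2]. *)
Lemma dot_sqr_le (R : realType) (N : nat) (a b : 'rV[R]_N) :
  dot a a <= dot a b -> dot a a <= dot b b.
Proof. by have := dot_ge0 (b - a); rewrite !dotE (dotC b a); lra. Qed.

(** Stands for the passage to the limit [t -> 0+]. If [a < 0], then [t = 1] forces [c > 0], and the
    value [t = - a / (2 * (c - a))], which lies between 0 and 1, makes [a + t * c] negative. *)
Lemma ge0_of_linear_perturbation (R : realType) (a c : R) :
  (forall t : R, 0 < t -> t <= 1 -> 0 <= a + t * c) -> 0 <= a.
Proof.
move=> h; rewrite leNgt; apply/negP => a0.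
have c0 : 0 < c by have := h 1 ltr01 (lexx 1); lra.
have d0 : 0 < c - a by lra.
have := h (- a / (2 * (c - a))).
have -> : a + - a / (2 * (c - a)) * c = a * (c - 2 * a) / (2 * (c - a)).
  by field; lra.
rewrite ler_pdivrMr; last by lra.
rewrite divr_gt0 ?oppr_gt0//; last by lra.
move=> /(_ isT); rewrite ler_pdivlMr; last by lra.
rewrite mul0r => hh.
have : 0 <= a * (c - 2 * a) by apply: hh; lra.
rewrite leNgt => /negP; apply; nra.
Qed.

(* [X w] is a subgradient at [w] of the convex function
   [h w = max_z (w . z - f z)].  Minimizing [h w + |w - (v + s x)|^2 / (2 s)]
   over a ball produces an interior [w] with [v + s x = w + s X w], and
   prox-regularity with [s > r / 2] then forces [X w = x], hence [w = v]. *)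
Lemma tilted_minimizer (R : realType) (N : nat) (f : 'rV[R]_N -> \bar R)
    (B : set 'rV[R]_N) (X : 'rV[R]_N -> 'rV[R]_N) (rho k r s : R)
    (x v : 'rV[R]_N) :
  0 <= rho -> 0 <= k -> 0 < s -> r / 2 < s ->
  (forall w, `|w| <= rho -> argmin (fun z => f z - (dot w z)%:E)%E B (X w)) ->
  (forall w w', `|w| <= rho -> `|w'| <= rho -> `|X w - X w'| <= k * `|w - w'|) ->
  B x -> f x \is a fin_num ->
  (forall z, B z ->
    (f x + (dot v (z - x) - r / 2 * dot (z - x) (z - x))%:E <= f z)%E) ->
  dot (s *: (x - X 0) + v) (s *: (x - X 0) + v) < rho ^+ 2 ->
  `|v| <= rho /\ X v = x.
Proof.
move=> rho0 k0 s0 rs Xmin Xlip Bx fx prox small.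
pose K := [set w : 'rV[R]_N | `|w| <= rho].
have K0 : K 0 by rewrite /K /= normr0.
have Kconv w w' t : K w -> K w' -> 0 <= t -> t <= 1 -> K (w + t *: (w' - w)).
  rewrite /K /= => Kw Kw' t0 t1.
  have -> : w + t *: (w' - w) = (1 - t) *: w + t *: w'.
    by apply/rowP => i; rewrite !mxE; ring.
  rewrite (le_trans (ler_normD _ _))// !normrZ !ger0_norm ?subr_ge0//.
  by have : 0 <= 1 - t by [lra|]; nra.
pose h w := dot w (X w) - fine (f (X w)).
have fX w : K w -> f (X w) \is a fin_num.
  move=> /Xmin[_ + _]; rewrite fin_numD => /andP[].
  by [].
have hX w z : K w -> B z -> f z \is a fin_num -> dot w z - fine (f z) <= h w.
  move=> Kw Bz fz; have [_ _ /(_ z Bz)] := Xmin w Kw.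
  rewrite -(fineK fz) -(fineK (fX w Kw)) -!EFinB lee_fin /h; lra.
(* Subgradient inequality for [h]: the point [X w] is a competitor in the maximum defining
   [h w']. *)
have hsub w w' : K w -> K w' -> h w + dot (w' - w) (X w) <= h w'.
  move=> Kw Kw'; have [BX _ _] := Xmin w Kw.
  by have := hX w' (X w) Kw' BX (fX w Kw); rewrite /h !dotE; lra.
(* [C] bounds [N * |X w|] on [K], hence the slopes of [h] in the sup norm. *)
pose C := N%:R * (`|X 0| + k * rho).
have C0 : 0 <= C by rewrite mulr_ge0// addr_ge0// mulr_ge0.
have hlip w w' : K w -> K w' -> h w - h w' <= C * `|w - w'|.
  move=> Kw Kw'; have := hsub w w' Kw Kw'.
  have XC : `|X w| <= `|X 0| + k * rho.
    rewrite -[X w](subrK (X 0)) (le_trans (ler_normD _ _))// addrC lerD2l.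
    rewrite (le_trans (Xlip _ _ Kw K0))// ler_wpM2l//.
    by rewrite subr0.
  have := normr_dot_le (w' - w) (X w); rewrite ler_norml distrC => /andP[+ _].
  have : N%:R * `|w - w'| * `|X w| <= C * `|w - w'|.
    rewrite /C -!mulrA ler_wpM2l// mulrC ler_wpM2r//.
  lra.
pose c := v + s *: x.
pose H w := h w + (2 * s)^-1 * dot (w - c) (w - c).
(* This makes [H] continuous on the compact ball [K], so that it attains its minimum there. *)
have Hlip : [lipschitz (H w : R^o) | w in K].
  pose C' := C + (2 * s)^-1 * (N%:R * (2 * rho + 2 * `|c|)).
  have s2 : 0 <= (2 * s)^-1 by rewrite invr_ge0 mulr_ge0// ltW.
  have C'0 : 0 <= C' by rewrite addr_ge0// !mulr_ge0// addr_ge0 ?mulr_ge0.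
  apply/lipschitzP; exists (C' + 1) => [|w w' Kw Kw']; first by rewrite ltr_wpDl.
  suff one a b : K a -> K b -> H a - H b <= (C' + 1) * `|a - b|.
    by rewrite ler_norml lerNl opprB one// andbT distrC one.
  move=> Ka Kb; have := hlip a b Ka Kb.
  have -> : H a - H b = h a - h b + (2 * s)^-1 * dot (a - b) (a + b - 2 *: c).
    by rewrite /H -dot_sqrB; ring.
  have : dot (a - b) (a + b - 2 *: c) <= N%:R * (2 * rho + 2 * `|c|) * `|a - b|.
    rewrite (le_trans (ler_norm _))// (le_trans (normr_dot_le _ _))//.
    rewrite mulrAC ler_wpM2r// ler_wpM2l//.
    rewrite (le_trans (ler_normB _ _))// normrZ ger0_norm// lerD2r.
    by rewrite (le_trans (ler_normD _ _))// mulr2n mulrDl mul1r lerD.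
  move=> /(ler_wpM2l s2); rewrite /C' !mulrDl mul1r -!mulrA.
  have := normr_ge0 (a - b); lra.
have [u Ku uH] : exists2 u, K u & forall w, K w -> H u <= H w.
  have cK : compact K.
    apply: bounded_closed_compact; last first.
      apply: closed_comp (@closed_le _ rho) => w _; exact: norm_continuous.
    exists rho; split=> [|M rM w /= Kw]; first exact: num_real.
    exact: le_trans Kw (ltW rM).
  have [] := compact_EVT_min _ cK (lipschitz_within_continuous Hlip).
    by exists 0.
  move=> u /set_mem Ku uH; exists u => // w Kw; apply: uH; exact: mem_set.
(* The subgradient [X u + s^-1 (u - c)] of [H] at [u], with [c = v + s x] expanded. *)
pose q := X u - x + s^-1 *: (u - v).
(* Compare [H] at [u] and [u + t d]. The subgradient inequality at [u + t d] bounds the growth of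
   [h] by [t d.X (u + t d)]; the Lipschitz bound replaces this by [t d.X u] up to an error of order
   [t^2]. Divide by [t] and let it vanish. *)
have first_order w : K w -> 0 <= dot (w - u) q.
  move=> Kw; pose d := w - u.
  pose E := N%:R * `|d| * (k * `|d|) + (2 * s)^-1 * dot d d.
  apply: (@ge0_of_linear_perturbation _ _ E) => t t0 t1.
  have Kt : K (u + t *: d) by apply: Kconv => //; exact: ltW.
  have := uH _ Kt; rewrite /H.
  have := hsub _ _ Kt Ku.
  have -> : u - (u + t *: d) = - (t *: d) by rewrite opprD addNKr.
  have : dot d (X (u + t *: d)) <= dot d (X u) + N%:R * `|d| * (k * (t * `|d|)).
    rewrite -lerBlDl -dotNr -dotDr (le_trans (ler_norm _))//.
    rewrite (le_trans (normr_dot_le _ _))// ler_wpM2l ?mulr_ge0//.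
    rewrite (le_trans (Xlip _ _ Kt Ku))// ler_wpM2l// addrAC subrr add0r.
    by rewrite normrZ gtr0_norm.
  rewrite -(ler_pM2l t0) !dotNl !dotZl => h1 h2 h3.
  rewrite -(pmulr_rge0 _ t0) -/d.
  have -> : t * (dot d q + t * E) = t * (dot d (X u) + N%:R * `|d| * (k * (t * `|d|)))
      + (2 * s)^-1 * (dot (u + t *: d - c) (u + t *: d - c) - dot (u - c) (u - c)).
    rewrite dot_sqrB [u + _ - u]addrAC subrr add0r /q /E /c !dotE.
    by field; rewrite gt_eqF.
  lra.
(* The minimizer is interior: the first-order condition towards 0 and the monotonicity of [X] give
   [|u|^2 <= u.a], hence [|u| <= |a| < rho] in the Euclidean norm. *)
have uu : dot u u < rho ^+ 2.
  apply: le_lt_trans small; set a := s *: (x - X 0) + v.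
  have := hsub _ _ Ku K0; have := hsub _ _ K0 Ku.
  rewrite sub0r subr0 dotNl => h1 h2.
  have := first_order _ K0; rewrite sub0r dotNl.
  have -> : dot u q = dot u (X u - X 0) + s^-1 * (dot u u - dot u a).
    by rewrite /q /a !dotE; field; rewrite gt_eqF.
  have : 0 <= dot u (X u - X 0) by rewrite !dotE; lra.
  move=> h3 h4; have : s^-1 * (dot u u - dot u a) <= 0 by lra.
  by rewrite pmulr_rle0 ?invr_gt0// subr_le0; exact: dot_sqr_le.
have Ku' : `|u| < rho.
  rewrite -(ltr_pXn2r (ltn0Sn 1)) ?nnegrE//.
  exact: le_lt_trans (sqr_norm_le_dot u) uu.
have q0 : q = 0.
  apply: dot_eq0.
  (* A step of length [t |q| <= rho - |u|] against [q] stays in [K]; the [+ 1] covers [q = 0]. *)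
  pose t := (rho - `|u|) / (`|q| + 1).
  have q1 : 0 < `|q| + 1 by rewrite ltr_wpDl.
  have t0 : 0 < t by rewrite divr_gt0// subr_gt0.
  have /first_order : K (u - t *: q).
    rewrite /K /= (le_trans (ler_normB _ _))// -lerBrDl normrZ gtr0_norm//.
    rewrite /t mulrAC ler_pdivrMr// ler_wpM2l ?subr_ge0 ?(ltW Ku')//.
    by rewrite lerDl.
  by rewrite addrAC subrr add0r dotNl dotZl oppr_ge0 pmulr_rle0.
have uv : u - v = s *: (x - X u).
  have /(congr1 (fun z => s *: z)) := q0.
  rewrite /q scalerDr scalerA divff ?gt_eqF// scale1r scaler0 => /eqP.
  by rewrite addrC addr_eq0 -scalerN opprB => /eqP.
(* Test the quadratic minorant of [f] at [z = X u], and the maximality of [X u] for the tilt [u]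
   against [x]. With [v = u + s (X u - x)] the sum reads [(s - r / 2) |X u - x|^2 <= 0]. *)
have Xx : X u = x.
  apply/eqP; rewrite -subr_eq0; apply/eqP/dot_eq0.
  have [BX _ _] := Xmin u Ku; have := prox _ BX.
  rewrite -(fineK fx) -(fineK (fX u Ku)) -EFinD lee_fin.
  have := hX u x Ku Bx fx; rewrite /h.
  have -> : dot v (X u - x) =
      dot u (X u) - dot u x + s * dot (X u - x) (X u - x).
    have {1}-> : v = u + s *: (X u - x) by rewrite -opprB scalerN -uv subKr.
    by rewrite dotDl dotZl dotDr dotNr.
  move=> h1 h2; have : (s - r / 2) * dot (X u - x) (X u - x) <= 0 by lra.
  rewrite pmulr_rle0//; lra.
move: uv; rewrite Xx subrr scaler0 => /eqP; rewrite subr_eq0 => /eqP uv.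
by rewrite -uv (ltW Ku').
Qed.

(** * Minimizers, their subgradients, and product neighborhoods *)

Lemma sub_argmin (R : realType) (T : Type) (f : T -> \bar R) (A B : set T) (x : T) :
  A `<=` B -> A x -> argmin f B x -> argmin f A x.
Proof. by move=> AB Ax [_ fx minx]; split=> // z /AB/minx. Qed.

Lemma ereal_inf_argmin (R : realType) (T : Type) (f : T -> \bar R) (A : set T)
    (x : T) : argmin f A x -> ereal_inf (f @` A) = f x.
Proof.
move=> [Ax _ minx]; apply/eqP; rewrite eq_le; apply/andP; split.
  by apply: ereal_inf_lbound; exists x.
by apply/ereal_infP => _ [z Az <-]; exact: minx.
Qed.

(** Minimality puts an affine function of slope [w] below [f] near [x], so [w] is a regular
    subgradient, and constant sequences witness the limiting one. *)
Lemma argmin_subdiff (R : realType) (N : nat) (f : 'rV[R]_N -> \bar R)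
    (B : set 'rV[R]_N) (x w : 'rV[R]_N) :
  nbhs x B -> argmin (fun z => f z - (dot w z)%:E)%E B x -> subdiff f x w.
Proof.
move=> xB [_ fwx minx]; have fx : f x \is a fin_num.
  by move: fwx; rewrite fin_numD => /andP[].
split=> //; exists (fun=> x), (fun=> w); split; try exact: cvg_cst.
move=> _; split=> // eps eps0; apply: filterS xB => z /minx.
rewrite -(fineK fx); have := enorm_ge0 (z - x).
case: (f z) => [t| |] //= n0; last by move=> _; exact: leey.
rewrite -!EFinB -!EFinD !lee_fin !dotE.
by have := mulr_ge0 (ltW eps0) n0; lra.
Qed.

Lemma norm_pair (R : realType) (V W : normedModType R) (a : V) (b : W) :
  `|(a, b)| = Num.max `|a| `|b|.
Proof. by rewrite prod_normE. Qed.

Lemma nbhs_setX_norm (R : realType) (V W : normedModType R) (x : V) (y : W)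
    (A : set V) (B : set W) :
  nbhs x A -> nbhs y B ->
  exists2 e : R, 0 < e & forall q : V * W, `|q - (x, y)| <= e -> (A `*` B) q.
Proof.
move=> /nbhs_norm_le[a a0 aA] /nbhs_norm_le[b b0 bB].
exists (Num.min a b) => [|[z w]]; first by rewrite lt_min a0.
rewrite norm_pair ge_max !le_min => /andP[/andP[za _] /andP[_ wb]].
by split; [exact: aA|exact: bB].
Qed.

(** * From full stability to a localization of [Mbar] *)

Lemma fully_stable_localization (R : realType) (n m : nat)
    (phi : 'rV[R]_(n + m) -> \bar R) (xbar : 'rV[R]_n) (ybar : 'rV[R]_m) :
  locally_optimal phi 0 0 xbar ->
  continuously_prox_regular phi xbar 0 0 ybar ->
  multipliers phi xbar 0 0 ybar ->
  fully_stable phi xbar ybar ->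
  exists (X : set 'rV[R]_n) (Y : set 'rV[R]_m)
         (V : set 'rV[R]_n) (U : set 'rV[R]_m),
    [/\ [/\ nbhs xbar X, nbhs ybar Y, nbhs (0 : 'rV[R]_n) V
          & nbhs (0 : 'rV[R]_m) U],
        single_valued_lipschitz (fun p => Mbar phi p `&` (X `*` Y)) (V `*` U)
      & forall v u x y, V v -> U u ->
          (Mbar phi (v, u) `&` (X `*` Y)) (x, y) ->
          argmin (objective phi v u) X x].
Proof.
move=> [X0 nX0 xopt] [Xp [Up [Vp [Yp [r [[nXp nUp nVp nYp] r0 prox _]]]]]] ymult
  [delta0 d0 stable].
have [e1 e10 e1P] : exists2 e : R, 0 < e &
    forall z, `|z - xbar| <= e -> (X0 `&` Xp) z.
  exact/nbhs_norm_le/filterI.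
(* Halving makes [delta] strictly smaller than both bounds: stability applies, and the Euclidean
   ball [B] lies in [X0] and [Xp]. *)
pose delta := Num.min delta0 e1 / 2.
have min0 : 0 < Num.min delta0 e1 by rewrite lt_min d0.
have dgt0 : 0 < delta by rewrite divr_gt0.
have dmin : delta < Num.min delta0 e1 by rewrite /delta; lra.
have [dd0 de1] : delta < delta0 /\ delta < e1.
  by move: dmin; rewrite lt_min => /andP.
have [V1 [U1 [nV1 nU1 [g [gE /lipschitzP[k k0 gk]]] _]]] := stable _ dgt0 dd0.
pose B := [set z : 'rV[R]_n | enorm (z - xbar) <= delta].
have BX z : B z -> X0 z /\ Xp z.
  move=> Bz; apply: e1P; rewrite (le_trans (norm_le_enorm _))//.
  exact: le_trans Bz (ltW de1).
have nB : nbhs xbar B by exact: nbhs_enorm_le.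
pose Y := [set y : 'rV[R]_m | enorm (y - ybar) <= delta] `&` Yp.
have nY : nbhs ybar Y by apply: filterI => //; exact: nbhs_enorm_le.
have [e e0 eP] : exists2 e : R, 0 < e & forall p : 'rV[R]_n * 'rV[R]_m,
    `|p - (0, 0)| <= e -> ((V1 `&` Vp) `*` (U1 `&` Up)) p.
  by apply: nbhs_setX_norm; exact: filterI.
have eP' v u : `|v| <= e -> `|u| <= e -> [/\ V1 v, Vp v, U1 u & Up u].
  move=> ve ue; have [] := eP (v, u); last by move=> [? ?] [? ?].
  by rewrite subr0 norm_pair ge_max ve.
have g_mem v u : `|v| <= e -> `|u| <= e ->
    Mbardelta phi xbar ybar delta (v, u) (g (v, u)).
  by move=> ve ue; have [V1v _ U1u _] := eP' v u ve ue; rewrite gE.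
have g0 : g (0, 0) = (xbar, ybar).
  have [V10 _ U10 _] : [/\ V1 0, Vp 0, U1 0 & Up 0].
    by apply: eP'; rewrite normr0 ltW.
  suff : Mbardelta phi xbar ybar delta (0, 0) (xbar, ybar) by rewrite gE// => ->.
  split=> //=; last first.
    by rewrite (le_trans (enorm_le_norm _))// subrr normr0 mulr0 ltW.
  apply: sub_argmin xopt => [z /BX[]//|] /=.
  by rewrite (le_trans (enorm_le_norm _))// subrr normr0 mulr0 ltW.
have glip v u v' u' : `|v| <= e -> `|u| <= e -> `|v'| <= e -> `|u'| <= e ->
    `|g (v, u) - g (v', u')| <= k * Num.max `|v - v'| `|u - u'|.
  move=> ve ue ve' ue'; have [? _ ? _] := eP' v u ve ue.
  by have [? _ ? _] := eP' v' u' ve' ue'; rewrite -norm_pair; exact: gk.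
have g1lip v u v' u' : `|v| <= e -> `|u| <= e -> `|v'| <= e -> `|u'| <= e ->
    `|(g (v, u)).1 - (g (v', u')).1| <= k * Num.max `|v - v'| `|u - u'|.
  move=> ve ue ve' ue'; apply: le_trans (glip v u v' u' ve ue ve' ue').
  by case: (g (v, u)) => a b; case: (g _) => a' b'; rewrite norm_pair le_max lexx.
(* Solves [n.+1 * (r * (1 + k) + 1) * eta = e / 2], the bound on the Euclidean norm obtained in
   [small]. *)
pose eta := e / (2 * n.+1%:R * (r * (1 + k) + 1)).
have den0 : 0 < 2 * n.+1%:R * (r * (1 + k) + 1) :> R.
  by rewrite !mulr_gt0// addr_gt0// mulr_gt0// addr_gt0.
have eta0 : 0 < eta by rewrite divr_gt0.
pose X := B `&` [set z | `|z - xbar| <= eta].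
have nX : nbhs xbar X by apply: filterI => //; apply/nbhs_norm_le; exists eta.
have [sig sig0 sigP] := nbhs_setX_norm nX nY.
(* The bounds [eta] and [e] serve [small] and the domain of [g]; [sig / k] keeps the values of [g]
   in [X] and [Y]. *)
pose theta := Num.min (Num.min eta e) (sig / k).
have theta0 : 0 < theta by rewrite !lt_min eta0 e0 divr_gt0.
have [[theta_eta theta_e] theta_sig] :
    (theta <= eta /\ theta <= e) /\ k * theta <= sig.
  have : theta <= theta by [].
  rewrite {2}/theta !le_min => /andP[/andP[-> ->] ]; split=> //.
  by rewrite mulrC -ler_pdivlMr.
have small v u x : `|v| <= theta -> `|u| <= theta -> X x ->
    dot (r *: (x - (g (0, u)).1) + v) (r *: (x - (g (0, u)).1) + v) < e ^+ 2.
  move=> vt ut [_ /= xeta]; set a := _ + v.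
  have ue := le_trans ut theta_e.
  have gu : `|xbar - (g (0, u)).1| <= k * eta.
    have -> : xbar = (g (0, 0)).1 by rewrite g0.
    have n0e : `|0 : 'rV[R]_n| <= e by rewrite normr0 ltW.
    have m0e : `|0 : 'rV[R]_m| <= e by rewrite normr0 ltW.
    apply: le_trans (g1lip _ _ _ _ n0e m0e n0e ue) _; rewrite (ler_wpM2l (ltW k0))//.
    by rewrite !sub0r oppr0 normr0 normrN ge_max (ltW eta0) (le_trans ut).
  have ha : `|a| <= (r * (1 + k) + 1) * eta.
    rewrite (le_trans (ler_normD _ _))// mulrDl mul1r lerD//; last first.
      exact: le_trans vt theta_eta.
    rewrite normrZ gtr0_norm// -mulrA (ler_wpM2l (ltW r0))//.
    by rewrite mulrDl mul1r (le_trans (ler_distD xbar _ _))// lerD.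
  rewrite -enorm_sqr ltr_pXn2r ?nnegrE ?enorm_ge0 ?ltW//.
  apply: (@le_lt_trans _ _ (e / 2)); last by lra.
  apply: le_trans (enorm_le_norm _) _.
  apply: (@le_trans _ _ (n.+1%:R * ((r * (1 + k) + 1) * eta))).
    by rewrite ler_wpM2l.
  rewrite /eta le_eqVlt; apply/orP; left; apply/eqP; field.
  by rewrite !gt_eqF// ltr_wpDr ?ler0n// mulr_gt0// addr_gt0.
have Mbar_g v u x y : `|v| <= theta -> `|u| <= theta ->
    Mbar phi (v, u) (x, y) -> X x -> Y y -> (x, y) = g (v, u).
  move=> vt ut xyM Xx [Yy Ypy].
  have ve := le_trans vt theta_e; have ue := le_trans ut theta_e.
  have [V1v Vpv U1u Upu] := eP' v u ve ue.
  have [Bx _] := Xx; have [_ Xpx] := BX x Bx.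
  have [fx _] := xyM.
  (* With [u] frozen, the prox-regularity inequality loses its [y] term and becomes a quadratic
     minorant of [phi(., u)]. The choice [s = r] satisfies [r / 2 < s]. *)
  have [||||||||||_ gx] := @tilted_minimizer R n (fun z => phi (row_mx z u)) B
    (fun w => (g (w, u)).1) e k r r x v => //.
  - exact: ltW.
  - exact: ltW.
  - by lra.
  - by move=> w we; have [] := g_mem w u we ue.
  - move=> w w' we we'; apply: le_trans (g1lip _ _ _ _ we ue we' ue) _.
    by rewrite subrr normr0 max_l.
  - move=> z /BX[_ Xpz].
    have := prox x u z u v y Xpx Upu Xpz Upu Vpv Ypy xyM.
    by rewrite enorm_sqr !dot_row_mx subrr (dotC y) !dot0l !addr0.
  - exact: small.
  (* Since [x] is the first component of [g (v, u)], it inherits from there its minimality over [B]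
     and the membership of [v] in [subdiff_x]. *)
  have [gmin [gsub _] _] := g_mem v u ve ue.
  suff : Mbardelta phi xbar ybar delta (v, u) (x, y) by rewrite gE// => ->.
  split=> //=; first by rewrite -gx.
  by split=> //; rewrite -gx.
have g_X v u : `|v| <= theta -> `|u| <= theta -> (X `*` Y) (g (v, u)).
  move=> vt ut; apply: sigP; rewrite -g0.
  have ve := le_trans vt theta_e; have ue := le_trans ut theta_e.
  apply: le_trans (glip _ _ _ _ ve ue _ _) _; rewrite ?normr0 ?(ltW e0)//.
  apply: le_trans theta_sig; rewrite (ler_wpM2l (ltW k0))//.
  by rewrite !subr0 ge_max vt.
exists X, Y, [set v | `|v| <= theta], [set u | `|u| <= theta]; split.
- by split=> //; apply/nbhs_norm_le; exists theta => // z; rewrite subr0.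
- exists g; split.
    move=> [v u] [/= vt ut]; apply/seteqP; split=> [[x y] [xyM [/= Xx Yy]]|_ ->].
      by apply: Mbar_g.
    split; last exact: g_X.
    by have [_ []] := g_mem v u (le_trans vt theta_e) (le_trans ut theta_e).
  apply/lipschitzP; exists k => // -[v u] [v' u'] [/= vt ut] [/= vt' ut'].
  by rewrite norm_pair; apply: glip; exact: le_trans theta_e.
- move=> v u x y /= vt ut [xyM [/= Xx Yy]].
  have [+ _ _] := g_mem v u (le_trans vt theta_e) (le_trans ut theta_e).
  rewrite -(Mbar_g v u x y)//; apply: sub_argmin => // z [] //.
Qed.

(** * From a localization of [Mbar] to full stability *)

Lemma localization_fully_stable (R : realType) (n m : nat)
    (phi : 'rV[R]_(n + m) -> \bar R) (xbar : 'rV[R]_n) (ybar : 'rV[R]_m)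
    (X : set 'rV[R]_n) (Y : set 'rV[R]_m) (V : set 'rV[R]_n) (U : set 'rV[R]_m) :
  continuously_prox_regular phi xbar 0 0 ybar ->
  multipliers phi xbar 0 0 ybar ->
  nbhs xbar X -> nbhs ybar Y -> nbhs (0 : 'rV[R]_n) V -> nbhs (0 : 'rV[R]_m) U ->
  single_valued_lipschitz (fun p => Mbar phi p `&` (X `*` Y)) (V `*` U) ->
  (forall v u x y, V v -> U u -> (Mbar phi (v, u) `&` (X `*` Y)) (x, y) ->
    argmin (objective phi v u) X x) ->
  fully_stable phi xbar ybar.
Proof.
move=> [Xp [Up [Vp [Yp [r [[nXp nUp nVp nYp] r0 prox _]]]]]] [_ ysub] nX nY nV nU
  [g [gE /lipschitzP[k k0 gk]]] xmin.
have [e e0 eP] : exists2 e : R, 0 < e & forall p : 'rV[R]_n * 'rV[R]_m,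
    `|p - (0, 0)| <= e -> ((V `&` Vp) `*` (U `&` Up)) p.
  by apply: nbhs_setX_norm; exact: filterI.
have [sig sig0 sigP] : exists2 e : R, 0 < e & forall q : 'rV[R]_n * 'rV[R]_m,
    `|q - (xbar, ybar)| <= e -> ((X `&` Xp) `*` (Y `&` Yp)) q.
  by apply: nbhs_setX_norm; exact: filterI.
have sigX z : `|z - xbar| <= sig -> X z /\ Xp z.
  move=> zx; have [] := sigP (z, ybar); last by move=> [].
  by rewrite norm_pair /= subrr normr0 ge_max zx ltW.
have sigY z : `|z - ybar| <= sig -> Y z /\ Yp z.
  move=> zy; have [] := sigP (xbar, z); last by move=> _ [].
  by rewrite norm_pair /= subrr normr0 ge_max zy ltW.
have eP' v u : `|v| <= e -> `|u| <= e -> [/\ V v, Vp v, U u & Up u].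
  move=> ve ue; have [] := eP (v, u); last by move=> [? ?] [? ?].
  by rewrite subr0 norm_pair ge_max ve.
have g0 : g (0, 0) = (xbar, ybar).
  have [V10 _ U10 _] : [/\ V 0, Vp 0, U 0 & Up 0].
    by apply: eP'; rewrite normr0 ltW.
  suff : (Mbar phi (0, 0) `&` (X `*` Y)) (xbar, ybar) by rewrite gE// => ->.
  by split=> //; split; [exact: nbhs_singleton nX|exact: nbhs_singleton nY].
(* For [delta < sig] the [delta]-balls around [xbar] and [ybar] lie in [X] and [Y]. *)
exists sig => // delta delta0 delta_sig.
(* [sig / 2] leaves room for a ball around the first component of [g p] inside [X]; the other two
   terms turn sup-norm bounds into Euclidean bounds by [delta]. *)
pose tau := Num.min (sig / 2) (Num.min (delta / n.+1%:R) (delta / m.+1%:R)).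
have tau0 : 0 < tau by rewrite !lt_min !divr_gt0.
have [tau_sig tau_n tau_m] :
    [/\ tau <= sig / 2, tau <= delta / n.+1%:R & tau <= delta / m.+1%:R].
  by have : tau <= tau by []; rewrite {2}/tau !le_min => /and3P[].
pose theta := Num.min e (tau / k).
have theta0 : 0 < theta by rewrite lt_min e0 divr_gt0.
have [theta_e theta_tau] : theta <= e /\ k * theta <= tau.
  have : theta <= theta by [].
  rewrite {2}/theta le_min => /andP[-> ]; split=> //.
  by rewrite mulrC -ler_pdivlMr.
pose P := [set p : 'rV[R]_n * 'rV[R]_m | `|p.1| <= theta /\ `|p.2| <= theta].
have P_VU p : P p -> [/\ V p.1, Vp p.1, U p.2 & Up p.2].
  by move=> [p1 p2]; apply: eP'; apply: le_trans theta_e.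
have glip p p' : P p -> P p' -> `|g p - g p'| <= k * `|p - p'|.
  by move=> /P_VU[? _ ? _] /P_VU[? _ ? _]; exact: gk.
have gbar p : P p -> `|(g p).1 - xbar| <= tau /\ `|(g p).2 - ybar| <= tau.
  move=> Pp; have P0 : P (0, 0) by split; rewrite /= normr0 ltW.
  have := glip p (0, 0) Pp P0; rewrite g0.
  have : `|p - (0, 0)| <= theta.
    by case: p Pp => v u [/= ? ?]; rewrite subr0 norm_pair ge_max; apply/andP.
  move=> /(ler_wpM2l (ltW k0)) h1 h2.
  have := le_trans (le_trans h2 h1) theta_tau.
  by case: (g p) => a b; rewrite norm_pair ge_max => /andP.
have gMbar p : P p -> (Mbar phi p `&` (X `*` Y)) (g p).
  by move=> /P_VU[? _ ? _]; rewrite gE.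
have gmin p : P p -> argmin (objective phi p.1 p.2) X (g p).1.
  move=> Pp; have [Vp1 _ Up2 _] := P_VU p Pp.
  have := gMbar p Pp; case: (g p) => x y.
  by case: p {Pp} Vp1 Up2 => v u /=; exact: xmin.
pose B := [set z : 'rV[R]_n | enorm (z - xbar) <= delta].
have BX : B `<=` X.
  move=> z Bz; apply: (sigX z _).1; rewrite (le_trans (norm_le_enorm _))//.
  exact: le_trans Bz (ltW delta_sig).
have gB p : P p -> argmin (objective phi p.1 p.2) B (g p).1.
  move=> Pp; apply: sub_argmin (gmin p Pp) => //.
  rewrite /B /= (le_trans (enorm_le_norm _))// mulrC -ler_pdivlMr//.
  exact: le_trans (gbar p Pp).1 tau_n.
have g_mem p : P p -> Mbardelta phi xbar ybar delta p (g p).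
  move=> Pp; split; first exact: gB.
    split; last by have [] := gMbar p Pp.
    apply: argmin_subdiff (gmin p Pp); apply/nbhs_norm_le.
    exists (sig / 2) => [|z zg]; first by rewrite divr_gt0.
    apply: (sigX z _).1; rewrite (le_trans (ler_distD (g p).1 _ _))//.
    rewrite [leRHS]splitr lerD//.
    exact: le_trans (gbar p Pp).1 tau_sig.
  rewrite (le_trans (enorm_le_norm _))// mulrC -ler_pdivlMr//.
  exact: le_trans (gbar p Pp).2 tau_m.
have VU_P p : [set v : 'rV[R]_n | `|v| <= theta] p.1 ->
  [set u : 'rV[R]_m | `|u| <= theta] p.2 -> P p by [].
exists [set v | `|v| <= theta], [set u | `|u| <= theta]; split.
- by apply/nbhs_norm_le; exists theta => // z; rewrite subr0.
- by apply/nbhs_norm_le; exists theta => // z; rewrite subr0.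
- exists g; split; last first.
    by apply/lipschitzP; exists k => // p p' [? ?] [? ?]; exact: glip.
  move=> p [p1 p2]; have Pp : P p by [].
  apply/seteqP; split=> [q [[qB _ _] [_ qsub] qY]|_ ->]; last exact: g_mem.
  have [Vp1 _ Up2 _] := P_VU p Pp.
  suff : (Mbar phi p `&` (X `*` Y)) q by rewrite gE.
  split=> //; split; first exact: BX.
  apply: (sigY q.2 _).1; rewrite (le_trans (norm_le_enorm _))//.
  exact: le_trans qY (ltW delta_sig).
have mE p : P p -> mdelta phi xbar delta p = objective phi p.1 p.2 (g p).1.
  by move=> Pp; apply: ereal_inf_argmin; exact: gB.
split=> [p [p1 p2]|].
  by rewrite mE//; have [] := gB p (VU_P p p1 p2).
have phi_fin p : P p -> phi (row_mx (g p).1 p.2) \is a fin_num.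
  by move=> /gMbar[[]].
have mE' p : P p -> fine (mdelta phi xbar delta p) =
    fine (phi (row_mx (g p).1 p.2)) - dot p.1 (g p).1.
  by move=> Pp; rewrite mE// /objective -{1}(fineK (phi_fin p Pp)).
(* One term each for the change of tilt, the multiplier applied to the change of [u], and the
   quadratic error, where one factor of the distance is bounded by [2 * theta]. *)
pose C := n%:R * (`|xbar| + tau) + m%:R * (`|ybar| + tau)
          + r / 2 * ((n%:R * (k * k) + m%:R) * (2 * theta)).
have C0 : 0 <= C.
  by rewrite !(addr_ge0, mulr_ge0)// ?ltW// invr_gt0.
apply/lipschitzP; exists (C + 1) => [|p p']; first by rewrite ltr_wpDl.
suff one q q' : P q -> P q' ->
    fine (mdelta phi xbar delta q) - fine (mdelta phi xbar delta q') <=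
    C * `|q' - q|.
  move=> [p1 p2] [p1' p2']; have Pp := VU_P p p1 p2; have Pp' := VU_P p' p1' p2'.
  have := one p p' Pp Pp'; have := one p' p Pp' Pp; rewrite (distrC p' p) => h1 h2.
  rewrite ler_norml mulrDl mul1r; have := normr_ge0 (p - p').
  by move=> h3; apply/andP; split; lra.
move=> Pq Pq'; rewrite !mE'//.
have [_ Vpq _ Upq] := P_VU q Pq; have [_ _ _ Upq'] := P_VU q' Pq'.
have Xp_g p1 : P p1 -> Xp (g p1).1.
  move=> Pp1; apply: (sigX _ _).2; apply: le_trans (gbar p1 Pp1).1 _; lra.
have Ypq : Yp (g q).2.
  apply: (sigY _ _).2; apply: le_trans (gbar q Pq).2 _; lra.
have [qsub _] := gMbar q Pq.
(* Prox-regularity at the solution for [q], tested at the solution for [q'], bounds the value at [q]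
   minus that at [q']; exchanging the two parameters gives the other side. *)
have := prox _ _ _ _ _ _ (Xp_g q Pq) Upq (Xp_g q' Pq') Upq' Vpq Ypq qsub.
rewrite -(fineK (phi_fin q Pq)) -(fineK (phi_fin q' Pq')) -EFinD lee_fin.
rewrite enorm_sqr !dot_row_mx.
set D := `|q' - q|.
have [D1 D2] : `|q'.1 - q.1| <= D /\ `|q'.2 - q.2| <= D.
  by rewrite /D; case: (q) (q') => a b [c d]; rewrite norm_pair !le_max !lexx orbT.
have D0 : 0 <= D by exact: normr_ge0.
have Dtheta : D <= 2 * theta.
  have Pn p1 : P p1 -> `|p1| <= theta.
    by case: p1 => a b [/= ? ?]; rewrite norm_pair ge_max; apply/andP.
  by rewrite (le_trans (ler_normB _ _))// mulr2n mulrDl mul1r lerD// Pn.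
have Dx : `|(g q').1 - (g q).1| <= k * D.
  apply: le_trans (glip q' q Pq' Pq).
  by case: (g q') (g q) => a b [c d]; rewrite norm_pair le_max lexx.
have gx : `|(g q').1| <= `|xbar| + tau.
  rewrite -[(g q').1](subrK xbar) addrC (le_trans (ler_normD _ _))// lerD2l.
  exact: (gbar q' Pq').1.
have gy : `|(g q).2| <= `|ybar| + tau.
  rewrite -[(g q).2](subrK ybar) addrC (le_trans (ler_normD _ _))// lerD2l.
  exact: (gbar q Pq).2.
have b1 : dot (q'.1 - q.1) (g q').1 <= n%:R * (`|xbar| + tau) * D.
  rewrite (le_trans (ler_norm _))// (le_trans (normr_dot_le _ _))//.
  by rewrite -!mulrA ler_wpM2l// mulrC ler_pM.
have b2 : - dot (g q).2 (q'.2 - q.2) <= m%:R * (`|ybar| + tau) * D.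
  rewrite -dotNr (le_trans (ler_norm _))// (le_trans (normr_dot_le _ _))//.
  by rewrite normrN -!mulrA ler_wpM2l// ler_pM.
have b3 : dot ((g q').1 - (g q).1) ((g q').1 - (g q).1)
          <= n%:R * (k * k) * (2 * theta) * D.
  rewrite (le_trans (ler_norm _))// (le_trans (normr_dot_le _ _))//.
  rewrite -!mulrA ler_wpM2l//.
  apply: (@le_trans _ _ ((k * D) * (k * D))); first exact: ler_pM.
  rewrite mulrACA -!mulrA !(ler_wpM2l (ltW k0))// mulrA.
  by rewrite ler_wpM2r.
have b4 : dot (q'.2 - q.2) (q'.2 - q.2) <= m%:R * (2 * theta) * D.
  rewrite (le_trans (ler_norm _))// (le_trans (normr_dot_le _ _))//.
  rewrite -!mulrA ler_wpM2l// mulrA.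
  by apply: (@le_trans _ _ (D * D)); [exact: ler_pM|rewrite ler_wpM2r].
have rb : r / 2 * (dot ((g q').1 - (g q).1) ((g q').1 - (g q).1)
      + dot (q'.2 - q.2) (q'.2 - q.2))
    <= r / 2 * ((n%:R * (k * k) * (2 * theta) * D) + m%:R * (2 * theta) * D).
  by rewrite ler_wpM2l ?lerD// ltW// divr_gt0.
have CD : C * D = n%:R * (`|xbar| + tau) * D + m%:R * (`|ybar| + tau) * D
    + r / 2 * ((n%:R * (k * k) * (2 * theta) * D) + m%:R * (2 * theta) * D).
  by rewrite /C; ring.
have dE : dot q.1 ((g q').1 - (g q).1) =
    dot q'.1 (g q').1 - dot q.1 (g q).1 - dot (q'.1 - q.1) (g q').1.
  by rewrite !dotE; ring.
by rewrite CD dE; lra.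
Qed.

(** * Equivalence of primal-dual full stability with the localization by minimizers *)

Theorem corollary1p6 (R : realType) (n m : nat)
    (phi : 'rV[R]_(n + m) -> \bar R) (xbar : 'rV[R]_n) (ybar : 'rV[R]_m)
    (phi_lsc : lower_semicontinuous phi)
    (phi_proper : proper_fun phi)
    (xbar_opt : locally_optimal phi 0 0 xbar)
    (phi_CQ : basic_CQ phi xbar 0)
    (phi_prox : forall yhat : 'rV[R]_m, multipliers phi xbar 0 0 yhat ->
       continuously_prox_regular phi xbar 0 0 yhat)
    (ybar_mult : multipliers phi xbar 0 0 ybar) :
  fully_stable phi xbar ybar <->
  exists (X : set 'rV[R]_n) (Y : set 'rV[R]_m)
         (V : set 'rV[R]_n) (U : set 'rV[R]_m),
    [/\ [/\ nbhs xbar X, nbhs ybar Y, nbhs (0 : 'rV[R]_n) V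
          & nbhs (0 : 'rV[R]_m) U],
        single_valued_lipschitz (fun p => Mbar phi p `&` (X `*` Y)) (V `*` U)
      & forall v u x y, V v -> U u ->
          (Mbar phi (v, u) `&` (X `*` Y)) (x, y) ->
          argmin (objective phi v u) X x].
Proof.
have ybar_prox := phi_prox ybar ybar_mult.
split; first exact: fully_stable_localization.
move=> [X [Y [V [U [[nX nY nV nU] lip xmin]]]]].
exact: localization_fully_stable ybar_prox ybar_mult nX nY nV nU lip xmin.
Qed.
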